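(* For every Perron number $\mu\ge2$ there exists a morphic infinite word $\mathbf w=w_0w_1w_2\cdots$ over $\{0,1\}$ such that, writing $n_0<n_1<n_2<\cdots$ for the increasing enumeration of $\{n: w_n=1\}$ (an infinite set), one has (1) $n_{j+1}/n_j\ge2$ for all $j\ge0$, and (2) $\limsup_{j\to\infty}n_{j+1}/n_j=\mu$.
   Context: A Perron number is a positive real algebraic integer strictly greater in absolute value than all its other conjugates. Morphic words: a morphism $h:\Sigma^*\to\Sigma^*$ on a finite alphabet is prolongable on $a$ if $h(a)=ax$, $x\in\Sigma^+$, and $h^n(x)$ is nonempty for all $n$; the limit $h^\omega(a)=a\,x\,h(x)h^2(x)\cdots$ is a pure morphic word; an infinite word is morphic if it is the image under a coding (letter-to-letter morphism) of a pure morphic word. Positions are indexed from $0$. *)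

(* Defs.v *)
From HB Require Import structures.
From mathcomp Require Import all_boot all_order all_algebra all_field.
Set Implicit Arguments. Unset Strict Implicit. Unset Printing Implicit Defensive.
Import Order.TTheory GRing.Theory Num.Theory.
Local Open Scope ring_scope.

Definition perron (mu : algC) : Prop :=
  [/\ mu \in Aint, 0 < mu &
      forall z : algC, root (minCpoly mu) z -> z != mu -> `|z| < mu].

Definition morph_word (S : Type) (h : S -> seq S) (u : seq S) : seq S :=
  flatten (map h u).

Definition morph_iter (S : Type) (h : S -> seq S) (n : nat) (u : seq S) : seq S :=
  iter n (morph_word h) u.

Definition prolongable (S : Type) (h : S -> seq S) (a : S) : Prop :=
  exists x : seq S, h a = a :: x /\ x <> [::] /\
    forall n, morph_iter h n x <> [::].

(* u is the infinite word h^omega(a) = lim h^n(a): every h^n(a) is a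
   prefix of u (positions indexed from 0). Together with prolongability
   (sizes of h^n(a) are unbounded) this determines u uniquely. *)
Definition is_homega (S : Type) (h : S -> seq S) (a : S) (u : nat -> S) : Prop :=
  prolongable h a /\
  forall n i, (i < size (morph_iter h n [:: a]))%N ->
    u i = nth a (morph_iter h n [:: a]) i.

Definition morphic_binary (w : nat -> bool) : Prop :=
  exists (S : finType) (h : S -> seq S) (a : S) (u : nat -> S) (c : S -> bool),
    is_homega h a u /\ forall n, w n = c (u n).

Definition limsup_eq (r : nat -> algC) (l : algC) : Prop :=
  (forall e : algC, 0 < e -> exists N, forall j, (N <= j)%N -> r j < l + e) /\
  (forall e : algC, 0 < e -> forall N, exists j, (N <= j)%N /\ l - e < r j).

(* Main.v *)
Require Import Defs.
From HB Require Import structures.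
From mathcomp Require Import all_boot all_order all_algebra all_field.
From mathcomp Require Import ring.
Import Order.TTheory GRing.Theory Num.Theory.

(** A word [a X h(X) h^2(X) ...] whose only ones head the blocks [h^j(X)] has
    its ones at [n_j = 1 + g_0 + ... + g_(j-1)], where [g_i = |h^i(X)|].  So it
    suffices to find a morphism with [g_(i+1) / g_i --> mu] and
    [2 g_i <= g_(i+1)].

    Following Lind, the letters are the finitely many points [q] of the lattice
    [Z[mu]] in a narrow cone [|sigma_k q| <= theta sigma_0 q] around the
    dominant embedding, with [sigma_0 q <= B].  Multiplication by [mu] contracts
    the cone by a factor [rho < 1]; so for [B] large the image of a letter can
    be cut into [K] almost equal lattice points, which are letters again.
    Spelling the letter [q] with [Tr q] symbols, a positive integer, makes
    lengths linear: [g_i = Tr (mu^i x0)],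
    without any Perron-Frobenius theory. *)

(** * The morphic word of a weighted substitution *)

Lemma morph_word_cat (S : Type) (h : S -> seq S) (u v : seq S) :
  morph_word h (u ++ v) = morph_word h u ++ morph_word h v.
Proof. by rewrite /morph_word map_cat flatten_cat. Qed.

Lemma morph_iter_cat (S : Type) (h : S -> seq S) (n : nat) (u v : seq S) :
  morph_iter h n (u ++ v) = morph_iter h n u ++ morph_iter h n v.
Proof. by elim: n => //= n ->; rewrite morph_word_cat. Qed.

Lemma morph_iterSr (S : Type) (h : S -> seq S) (n : nat) (u : seq S) :
  morph_iter h n.+1 u = morph_iter h n (morph_word h u).
Proof. exact: iterSr. Qed.

Section WeightedWord.

Variables (T : finType) (H : T -> seq T) (l : T -> nat) (x0 : T).
Hypothesis H_neq0 : forall x, H x <> [::].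
Hypothesis l_gt0 : forall x, 0 < l x.

(* [None] is the letter on which the morphism is prolongable, [Some None] an
   erased padding letter; a letter [x : T] is spelled with [l x] symbols, its
   head carrying a flag inherited by the first letter of its image. *)
Definition alphabet : finType := option (option (T * bool)).

Fixpoint expand (f : bool) (s : seq T) : seq alphabet :=
  if s is y :: s' then
    Some (Some (y, f)) :: nseq (l y).-1 (Some None) ++ expand false s'
  else [::].

Definition expand_morph (z : alphabet) : seq alphabet :=
  match z with
  | None => None :: expand true [:: x0]
  | Some None => [::]
  | Some (Some (x, f)) => expand f (H x)
  end.

Definition flagged (z : alphabet) : bool :=
  if z is Some (Some (_, f)) then f else false.

Definition weight (i : nat) : nat := \sum_(y <- morph_iter H i [:: x0]) l y.

(** The leading 1 counts the starting letter [None], at position 0; block [j] begins at position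
    [marker j]. *)
Definition marker (j : nat) : nat := (1 + \sum_(i < j) weight i)%N.

(** The flag goes to the first letter only, so [s1] has to be nonempty to absorb it. *)
Lemma expand_cat f s1 s2 : s1 <> [::] ->
  expand f (s1 ++ s2) = expand f s1 ++ expand false s2.
Proof.
elim: s1 f => // y s1 IH f _ /=; rewrite -catA; congr (_ :: (_ ++ _)).
by case: s1 IH => // z s1 ->.
Qed.

Lemma size_expand f s : size (expand f s) = \sum_(y <- s) l y.
Proof.
elim: s f => [|y s IH] f; first by rewrite big_nil.
by rewrite big_cons /= size_cat size_nseq IH -addSn prednK.
Qed.

(** The head of a letter produces its whole image and the padding is erased, so spelling commutes
    with substitution. *)
Lemma morph_word_expand f s :
  morph_word expand_morph (expand f s) = expand f (morph_word H s).
Proof.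
elim: s f => //= y s IH f.
rewrite -cat1s !morph_word_cat IH -[y :: s]cat1s morph_word_cat.
have pad k : morph_word expand_morph (nseq k (Some None)) = [::] by elim: k.
by rewrite pad /morph_word /= !cats0 expand_cat.
Qed.

Lemma morph_iter_expand f s n :
  morph_iter expand_morph n (expand f s) = expand f (morph_iter H n s).
Proof. by elim: n => //= n ->; rewrite morph_word_expand. Qed.

Lemma morph_iter_neq0 s n : s <> [::] -> morph_iter H n s <> [::].
Proof.
move=> s0; elim: n => //= n; case: (morph_iter H n s) => // y t _.
rewrite /morph_word /=.
by case: (H y) (H_neq0 y).
Qed.

Lemma weight_gt0 i : 0 < weight i.
Proof.
rewrite /weight; case: (morph_iter H i [:: x0]) (@morph_iter_neq0 [:: x0] i).
  by case.
by move=> y s _; rewrite big_cons addn_gt0 l_gt0.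
Qed.

Lemma markerS j : marker j.+1 = (marker j + weight j)%N.
Proof. by rewrite /marker big_ord_recr /= addnA. Qed.

Lemma marker_gt j : j < marker j.
Proof.
elim: j => // j IH; rewrite markerS -addn1.
by apply: leq_add => //; exact: weight_gt0.
Qed.

Let prefix_word n := morph_iter expand_morph n [:: None].

(** The morphism sends [None] to [None X], so its iterate [n.+1] at [None] is iterate [n] at [None]
    followed by iterate [n] at [X]. *)
Lemma prefix_wordS n :
  prefix_word n.+1 = prefix_word n ++ expand true (morph_iter H n [:: x0]).
Proof.
rewrite /prefix_word morph_iterSr -morph_iter_expand -morph_iter_cat.
by rewrite /morph_word /= cats0.
Qed.

Lemma size_prefix_word n : size (prefix_word n) = marker n.
Proof.
elim: n => [|n IH]; first by rewrite /marker big_ord0.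
by rewrite prefix_wordS size_cat IH size_expand markerS.
Qed.

Lemma nth_prefix_word m n i : m <= n -> i < marker m ->
  nth None (prefix_word n) i = nth None (prefix_word m) i.
Proof.
move=> /subnK <- im; elim: (n - m) => // k IH.
rewrite addSn prefix_wordS nth_cat size_prefix_word.
suff -> : i < marker (k + m) by exact: IH.
elim: (k) => // k' IHk; rewrite addSn markerS.
by apply: leq_trans IHk _; exact: leq_addr.
Qed.

Lemma flagged_expand s i : s <> [::] ->
  flagged (nth None (expand true s) i) = (i == 0).
Proof.
have nfl s' k : flagged (nth None (expand false s') k) = false.
  elim: s' k => [|y s' IH] k /=; first by rewrite nth_nil.
  case: k => //= k; rewrite nth_cat size_nseq; case: ifP => // kl.
  by rewrite nth_nseq kl.
case: s i => // y s [|i] _ //=; rewrite nth_cat size_nseq; case: ifP => // il.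
by rewrite nth_nseq il.
Qed.

Lemma flagged_prefix_word n k : k < marker n ->
  flagged (nth None (prefix_word n) k) <-> exists2 j, j < n & marker j = k.
Proof.
elim: n => [|n IH] kn.
  move: kn; rewrite /marker big_ord0 addn0 ltnS leqn0 => /eqP -> /=.
  by split => // [[]].
rewrite prefix_wordS nth_cat size_prefix_word; case: ltnP => kn'.
  apply: iff_trans (IH kn') _; split=> [] [j jn jk]; exists j => //.
    exact: ltnW.
  move: jn; rewrite ltnS leq_eqVlt => /orP[/eqP jn|//].
  by move: kn'; rewrite -jk jn ltnn.
(* In the last block only offset 0 is flagged, and this is position [marker n]. *)
rewrite flagged_expand; last exact: morph_iter_neq0.
rewrite subn_eq0; split=> [kn''|[j]].
  by exists n => //; apply/eqP; rewrite eqn_leq kn' kn''.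
rewrite ltnS => jn <-; move: jn => /subnK <-.
by elim: (n - j) => // i; rewrite addSn markerS => /leq_trans -> //;
  exact: leq_addr.
Qed.

Lemma weighted_word :
  exists w : nat -> bool, morphic_binary w /\
    forall k, w k = true <-> exists j, marker j = k.
Proof.
(* A diagonal limit: [i < marker i], so prefix [i] already contains position [i] and the default is
   never read. *)
pose u i := nth None (prefix_word i) i.
exists (flagged \o u); split.
  exists alphabet, expand_morph, None, u, flagged; split=> //; split.
    exists (expand true [:: x0]); split=> //; split=> // n.
    rewrite morph_iter_expand => /(congr1 size)/eqP.
    by rewrite size_expand eqn0Ngt weight_gt0.
  move=> n i; rewrite -/(prefix_word n) size_prefix_word => i_n.
  have [ni|/ltnW ni] := leqP n i.
    by rewrite /u (@nth_prefix_word n).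
  by rewrite [RHS](@nth_prefix_word i) //; exact: marker_gt.
move=> k; apply: iff_trans (@flagged_prefix_word k k (marker_gt k)) _;
  split=> [[j _ jk]|[j jk]]; exists j => //.
by rewrite -jk marker_gt.
Qed.

End WeightedWord.

Local Open Scope ring_scope.

(** * Limits of ratios *)

Lemma exists_nat_gt (x : algC) : 0 <= x -> exists n : nat, x < n%:R.
Proof. by move=> x0; exists (Num.bound x); exact: archi_boundP. Qed.

Lemma expr_le_small (rho e : algC) : 0 <= rho -> rho < 1 -> 0 < e ->
  exists J, forall j, (J <= j)%N -> rho ^+ j <= e.
Proof.
move=> rho0 rho1 e0; have d0 : 0 < 1 - rho by rewrite subr_gt0.
(* Bernoulli's inequality for [rho^-1], with denominators cleared. *)
have bern n : rho ^+ n * (1 + n%:R * (1 - rho)) <= 1.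
  elim: n => [|n IH]; first by rewrite expr0 mul1r mul0r addr0.
  apply: le_trans IH; rewrite exprSr -mulrA; apply: ler_wpM2l;
    first exact: exprn_ge0.
  rewrite -subr_ge0.
  have -> : 1 + n%:R * (1 - rho) - rho * (1 + n.+1%:R * (1 - rho)) =
     (n%:R + 1) * (1 - rho) ^+ 2 by rewrite -addn1 natrD; ring.
  by rewrite mulr_ge0 ?exprn_ge0 ?ltW // ltr_wpDl.
have [|N NP] := @exists_nat_gt ((e * (1 - rho))^-1).
  by rewrite invr_ge0 ltW // mulr_gt0.
(* Here [e * j * (1 - rho) > 1], so [rho ^+ j] is at most [e * rho ^+ j * (1 + j * (1 - rho))],
   which Bernoulli bounds by [e]. *)
exists N => j Nj; rewrite -[e]mulr1;
  apply: le_trans (ler_wpM2l (ltW e0) (bern j)).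
rewrite mulrCA ler_peMr ?exprn_ge0 // mulrDr mulr1 ler_wpDl ?ltW //.
rewrite mulrCA -ltr_pdivrMr ?mulr_gt0 // mul1r.
by apply: lt_le_trans NP _; rewrite ler_nat.
Qed.

(** A Stolz-Cesaro argument: the defect [n_(j+1) - mu n_j] grows by [g_(j+1) - mu g_j] at each step,
    hence stays below a constant plus a small multiple of [n_j]. *)
Lemma ratio_cvg (g n : nat -> nat) (mu : algC) :
  (forall j, j < n j)%N ->
  (forall j, n j.+1 = n j + g j)%N ->
  (forall e : algC, 0 < e -> exists I, forall i, (I <= i)%N ->
     `|(g i.+1)%:R - mu * (g i)%:R| <= e * (g i)%:R) ->
  forall e : algC, 0 < e -> exists J, forall j, (J <= j)%N ->
     `|(n j.+1)%:R / (n j)%:R - mu| < e.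
Proof.
move=> n_gt nS gP e e0; have e3 : 0 < e / 3 by rewrite divr_gt0 // ltr0n.
have [I IP] := gP _ e3; pose D := `|(n I.+1)%:R - mu * (n I)%:R|.
have bnd k :
    `|(n (k + I).+1)%:R - mu * (n (k + I)%N)%:R| <=
      D + e / 3 * (n (k + I)%N)%:R.
  elim: k => [|k]; first by rewrite add0n ler_wpDr // mulr_ge0 ?ler0n ?ltW.
  rewrite addSn; move: (k + I)%N (IP _ (leq_addl k I)) => m IPm IH.
  rewrite (nS m.+1) natrD (_ : _ - _ = ((n m.+1)%:R - mu * (n m)%:R)
    + ((g m.+1)%:R - mu * (g m)%:R)); last by rewrite (nS m) !natrD; ring.
  rewrite [in X in _ <= X](nS m) natrD.
  rewrite mulrDr [leRHS]addrA; apply: le_trans (ler_normD _ _) _.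
  by apply: lerD; [exact: IH | exact: IPm].
(* From rank [N] on, [n_j > j] puts the constant [D] below [e / 3 * n_j]. *)
have [|N NP] := @exists_nat_gt (D / (e / 3));
  first by rewrite divr_ge0 ?normr_ge0 ?(ltW e3).
exists (maxn I N) => j; rewrite geq_max => /andP[/subnK <- Nj].
move: (_ - _)%N (bnd (j - I)%N) Nj => k bk Nj.
have n0 : 0 < (n (k + I)%N)%:R :> algC by rewrite ltr0n (leq_trans _ (n_gt _)).
rewrite -(ltr_pM2r n0) -[X in _ * X < _](gtr0_norm n0) -normrM mulrBl divfK
  ?gt_eqF //.
apply: le_lt_trans bk _.
have DN : D < e / 3 * (n (k + I)%N)%:R.
  rewrite mulrC -ltr_pdivrMr //; apply: lt_le_trans NP _; rewrite ler_nat.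
  by apply: leq_trans Nj (ltnW (n_gt _)).
rewrite [X in _ < X](_ : _ = e / 3 * (n (k + I)%N)%:R + e / 3 * (n (k + I)%N)%:R
  + e / 3 * (n (k + I)%N)%:R); last by field.
by apply: ltr_wpDr; rewrite ?ltrD2r // mulr_ge0 ?ler0n ?ltW.
Qed.

(** The order of [algC] is partial; realness turns the bound on the norm into two inequalities. *)
Lemma limsup_eq_cvg (r : nat -> algC) (l : algC) :
  (forall j, r j \is Num.real) -> l \is Num.real ->
  (forall e : algC, 0 < e -> exists J, forall j, (J <= j)%N ->
     `|r j - l| < e) ->
  limsup_eq r l.
Proof.
move=> rR lR cv; split=> e e0; have [J JP] := cv e e0.
  exists J => j /JP; rewrite real_ltr_distl ?rpredB //.
  by case/andP.
move=> N; exists (maxn J N); rewrite leq_maxr; split=> //.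
have /JP := leq_maxl J N; rewrite real_ltr_distl ?rpredB //.
by case/andP.
Qed.

(** * Lattice points in the dominant cone *)

Section Conjugates.

Import Pdiv.Ring Pdiv.RingMonic.

Variables (m : nat) (lam : 'I_m.+1 -> algC) (P : {poly int}).
Hypothesis P_monic : P \is monic.
Hypothesis P_roots : map_poly intr P = \prod_k ('X - (lam k)%:P).
Hypothesis lam_inj : injective lam.

(** The embedding [sigma_k]. Lattice points are classes modulo [P], represented by integer
    polynomials of size at most [m.+1]. *)
Definition ev (k : 'I_m.+1) (q : {poly int}) : algC :=
  (map_poly intr q).[lam k].

Lemma evD k p q : ev k (p + q) = ev k p + ev k q.
Proof. by rewrite /ev rmorphD hornerD. Qed.

Lemma evM k p q : ev k (p * q) = ev k p * ev k q.
Proof. by rewrite /ev rmorphM hornerM. Qed.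

Lemma evMn k p n : ev k (p *+ n) = n%:R * ev k p.
Proof. by rewrite /ev rmorphMn hornerMn mulr_natl. Qed.

Lemma evXn k n : ev k 'X^n = lam k ^+ n.
Proof. by rewrite /ev map_polyXn hornerXn. Qed.

Lemma ev_coef k (q : {poly int}) : (size q <= m.+1)%N ->
  ev k q = \sum_(i < m.+1) (q`_i)%:~R * lam k ^+ i.
Proof.
move=> q_m; rewrite /ev (@horner_coef_wide _ m.+1).
  by apply: eq_bigr => i _; rewrite coef_map.
exact: leq_trans (size_poly _ _) q_m.
Qed.

Lemma size_P : size P = m.+2.
Proof.
rewrite -(@size_map_inj_poly _ _ (intr : int -> algC)) //; last exact: intr_inj.
by rewrite P_roots size_prod_XsubC [index_enum _]unlock -enumT size_enum_ord.
Qed.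

Lemma size_modP q : (size (rmodp q P) <= m.+1)%N.
Proof. by rewrite -ltnS -size_P ltn_rmodpN0 // monic_neq0. Qed.

Lemma ev_modP k q : ev k (rmodp q P) = ev k q.
Proof.
rewrite [in RHS](rdivp_eq P_monic q) evD evM.
rewrite [X in _ * X + _](_ : _ = 0) ?mulr0 ?add0r //.
by rewrite /ev P_roots (bigD1 k) //= hornerM hornerXsubC subrr mul0r.
Qed.

Let V : 'M[algC]_m.+1 := Vandermonde m.+1 (\row_k lam k).

Lemma V_unit : V \in unitmx.
Proof.
rewrite unitmxE det_Vandermonde unitfE; apply/prodf_neq0 => i _.
apply/prodf_neq0 => j ij; rewrite !mxE subr_eq0 (inj_eq lam_inj).
by rewrite gt_eqF.
Qed.

(** The conjugates are the coefficients times an invertible Vandermonde matrix, so bounded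
    conjugates force bounded coefficients. This makes the set of letters finite. *)
Lemma coef_bound : exists2 C : algC, 0 <= C &
  forall (q : {poly int}) b, (size q <= m.+1)%N -> (forall k, `|ev k q| <= b) ->
  forall i, `|(q`_i)%:~R : algC| <= C * b.
Proof.
exists (\sum_k \sum_i `|invmx V k i|).
  by apply: sumr_ge0 => k _; apply: sumr_ge0.
move=> q b q_m qb i; have b0 : 0 <= b by apply: le_trans (qb ord0).
have [mi|im] := leqP m.+1 i.
  rewrite nth_default ?(leq_trans q_m) // normr0 mulr_ge0 //.
  by apply: sumr_ge0 => k _; apply: sumr_ge0.
have qV : (\row_j (q`_j)%:~R) = (\row_k ev k q) *m invmx V.
  rewrite -[LHS](mulmxK V_unit); congr (_ *m _); apply/rowP => k.
  rewrite !mxE ev_coef //; apply: eq_bigr => j _.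
  by rewrite !mxE.
have := congr1 (fun M : 'rV_m.+1 => M 0 (Ordinal im)) qV; rewrite !mxE /= => ->.
apply: le_trans (ler_norm_sum _ _ _) _; rewrite mulr_suml;
  apply: ler_sum => k _.
rewrite mxE normrM mulrC; apply: ler_pM => //.
by rewrite (bigD1 (Ordinal im)) //= lerDl sumr_ge0.
Qed.

(* The sum of the conjugates is the trace of the integer matrix of
   multiplication by [q]. *)
Lemma sum_ev_int q : \sum_k ev k q \in Num.int.
Proof.
pose M : 'M[algC]_m.+1 := \matrix_(i, j) ((rmodp ('X^i * q) P)`_j)%:~R.
(* Column [k] of [V] is an eigenvector of [M] with eigenvalue [ev k q]. *)
have MV : M *m V = V *m diag_mx (\row_k ev k q).
  apply/matrixP => i k; rewrite mul_mx_diag !mxE.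
  rewrite -evXn -evM -ev_modP ev_coef ?size_modP //.
  by apply: eq_bigr => j _; rewrite !mxE.
suff <- : \tr M = \sum_k ev k q by apply: rpred_sum => i _;
  rewrite mxE intr_int.
rewrite -[M](mulmxK V_unit) MV mxtrace_mulC mulKmx ?V_unit // mxtrace_diag.
by apply: eq_bigr => k _; rewrite mxE.
Qed.

(** Euclidean division of each coefficient: those of [r] lie in [[0, K)], so its conjugates are
    bounded independently of [q]. *)
Lemma divide_poly (K : nat) : (0 < K)%N -> exists2 D : algC, 0 <= D &
  forall q : {poly int}, (size q <= m.+1)%N -> exists p r : {poly int},
   [/\ (size p <= m.+1)%N, (size r <= m.+1)%N, q = p *+ K + r &
      forall k, `|ev k r| <= D].
Proof.
move=> K0; exists (\sum_k \sum_(i < m.+1) K%:R * `|lam k ^+ i|).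
  by apply: sumr_ge0 => k _; apply: sumr_ge0 => i _; rewrite mulr_ge0.
move=> q q_m; exists (\poly_(i < m.+1) (q`_i %/ K)%Z),
  (\poly_(i < m.+1) (q`_i %% K)%Z).
rewrite !size_poly; split=> //.
  apply/polyP => i; rewrite coefD coefMn !coef_poly; case: ltnP => im.
    by rewrite {1}(divz_eq q`_i K) -mulr_natr natz.
  by rewrite mul0rn addr0 nth_default // (leq_trans q_m).
move=> k; rewrite ev_coef ?size_poly //; apply: le_trans (ler_norm_sum _ _ _) _.
rewrite [leRHS](bigD1 k) //=; apply: ler_wpDr.
  by apply: sumr_ge0 => j _; apply: sumr_ge0 => i _; rewrite mulr_ge0.
apply: ler_sum => i _; rewrite normrM; apply: ler_wpM2r => //.
rewrite coef_poly ltn_ord -intr_norm -[K%:R]/((K : int)%:~R) ler_int.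
by rewrite ger0_norm ?modz_ge0 ?ltW ?ltz_pmod // lt0r_neq0.
Qed.

Lemma finitely_many_bounded (N : nat) : exists s : seq {poly int},
  forall q : {poly int}, (size q <= m.+1)%N -> (forall i, `|q`_i| <= N%:Z)
    -> q \in s.
Proof.
(* Coefficients in [[-N, N]] are shifted by [N] to become ordinals. *)
pose dec (t : {ffun 'I_m.+1 -> 'I_(N + N).+1}) : {poly int} :=
  \poly_(i < m.+1) ((t (inord i) : nat)%:Z - N%:Z).
exists [seq dec t | t : {ffun 'I_m.+1 -> 'I_(N + N).+1}] => q q_m qN.
apply/imageP; exists [ffun i : 'I_m.+1 => inord (absz (q`_i + N%:Z)%R)] => //.
apply/polyP => i; rewrite coef_poly; case: ltnP => im; last first.
  by rewrite nth_default // (leq_trans q_m).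
have := qN i; rewrite ler_norml => /andP[q1 q2]; rewrite ffunE (inordK im).
have q0 : 0 <= q`_i + N%:Z by rewrite -lerBlDr sub0r.
rewrite inordK; first by rewrite gez0_abs // addrK.
by rewrite ltnS -lez_nat gez0_abs // PoszD lerD2r.
Qed.

(** * Cutting lattice points inside the cone *)

Variables (theta rho : algC).
Hypothesis theta_gt0 : 0 < theta.
Hypothesis rho_gt0 : 0 < rho.
Hypothesis rho_lt1 : rho < 1.
Hypothesis lam_gt0 : 0 < lam ord0.
Hypothesis lam_dom : forall k, k != ord0 -> `|lam k| <= rho * lam ord0.

Definition in_cone (q : {poly int}) : bool :=
  (0 < ev ord0 q) && [forall k,
    (k != ord0) ==> (`|ev k q| <= theta * ev ord0 q)].

Definition bounded_cone (B : algC) (q : {poly int}) : bool :=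
  [&& (size q <= m.+1)%N, in_cone q & ev ord0 q <= B].

Lemma in_coneP q : reflect
  (0 < ev ord0 q /\ forall k, k != ord0 -> `|ev k q| <= theta * ev ord0 q)
  (in_cone q).
Proof.
apply: (iffP andP) => [[q0 /forallP qk]|[q0 qk]]; split=> //.
  by move=> k; apply/implyP.
by apply/forallP => k; apply/implyP; exact: qk.
Qed.

Lemma ev0_real q : ev ord0 q \is Num.real.
Proof.
rewrite /ev horner_coef rpred_sum // => i _; rewrite coef_map /=.
by apply: rpredM; [exact: realz | apply: rpredX; exact: gtr0_real].
Qed.

(* [w] stands for the [K]-th part of the image of a letter: it lies in the cone
   narrowed by [rho], which leaves room for the rounding error [D]. *)
Lemma cone_piece (B D W : algC) (w : 'I_m.+1 -> algC) (z : {poly int}) :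
  (size z <= m.+1)%N -> (forall k, `|ev k z - w k| <= D) -> w ord0 = W ->
  0 < W -> (forall k, k != ord0 -> `|w k| <= rho * theta * W) ->
  D * (1 + theta) <= (1 - rho) * theta * W -> W + D <= B ->
  bounded_cone B z.
Proof.
move=> z_m zw w0 W0 wk DW WB.
have D0 : 0 <= D := le_trans (normr_ge0 _) (zw ord0).
have := zw ord0; rewrite w0 real_ler_distl ?rpredB ?ev0_real ?gtr0_real //.
case/andP=> Wz zW.
have DrW : D <= (1 - rho) * W.
  rewrite -(ler_pM2r theta_gt0) mulrAC; apply: le_trans DW.
  by rewrite mulrDr mulr1 ler_wpDl.
have rWz : rho * W <= ev ord0 z.
  apply: le_trans Wz; rewrite lerBrDr -lerBrDl; apply: le_trans DrW _.
  by rewrite mulrBl mul1r.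
apply/and3P; split=> //; last exact: le_trans zW WB.
apply/in_coneP; split; first by apply: lt_le_trans rWz; rewrite mulr_gt0.
move=> k k0; rewrite -[ev k z](subrK (w k)); apply: le_trans (ler_normD _ _) _.
apply: le_trans (lerD (zw k) (wk k k0)) _.
(* The bound [D + rho * theta * W <= theta * (W - D)] is a rearrangement of [DW]. *)
apply: (@le_trans _ _ (theta * (W - D))); last by rewrite ler_pM2l.
rewrite -subr_ge0 (_ : _ - _ = (1 - rho) * theta * W - D * (1 + theta)).
  by rewrite subr_ge0.
by ring.
Qed.

Lemma cone_split : exists2 B0 : algC, 0 <= B0 & forall (B : algC) q, B0 <= B ->
  bounded_cone B q -> exists s : seq {poly int},
  [/\ s <> [::], all (bounded_cone B) s &
      forall k, \sum_(y <- s) ev k y = lam k * ev k q].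
Proof.
(* With [K > 2 lam_0], the [K]-th part of an image is at most [B / 2] in the dominant embedding. *)
have [|K KP] := @exists_nat_gt (lam ord0 * 2); first by rewrite mulr_ge0 ?ltW.
have K0 : 0 < K%:R :> algC by apply: le_lt_trans KP; rewrite mulr_ge0 ?ltW.
have [|D D0 DP] := @divide_poly K; first by move: K0; rewrite ltr0n.
have rt0 : 0 < (1 - rho) * theta by rewrite mulr_gt0 // subr_gt0.
have t1 : 0 <= 1 + theta by rewrite ler_wpDr ?ltW.
(* The first term gives [D <= B / 2]; the second makes pieces larger than [B / K] absorb the
   rounding error in the cone condition. *)
exists (D * 2 + K%:R * (D * (1 + theta) / ((1 - rho) * theta))).
  by rewrite addr_ge0 ?mulr_ge0 ?invr_ge0 ?(ltW rt0) ?ler0n.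
move=> B q B0B /and3P[q_m /in_coneP[q0 qk] qB].
pose q' := rmodp ('X * q) P.
have q'_m : (size q' <= m.+1)%N := size_modP _.
have evq' k : ev k q' = lam k * ev k q.
  by rewrite ev_modP evM -['X]expr1 evXn expr1.
have q'0 : 0 < ev ord0 q' by rewrite evq' mulr_gt0.
have q'k k : k != ord0 -> `|ev k q'| <= rho * theta * ev ord0 q'.
  move=> k0; rewrite !evq' normrM [leRHS](_ :
    _ = (rho * lam ord0) * (theta * ev ord0 q)).
    by apply: ler_pM; rewrite ?lam_dom ?qk.
  by ring.
(* An image still below [B] is itself a letter; a larger one is cut. *)
have [q'B|Bq'] := real_leP (ev0_real q') (ger0_real (le_trans (ltW q0) qB)).
  exists [:: q']; split=> //; last by move=> k; rewrite big_seq1.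
  rewrite /= andbT; apply/and3P; split=> //; apply/in_coneP; split=> // k k0.
  apply: le_trans (q'k _ k0) _; rewrite -mulrA ler_piMl ?ltW //.
  by rewrite mulr_gt0.
have [p [r [p_m r_m q'E rD]]] := DP _ q'_m.
have evE k : ev k q' = K%:R * ev k p + ev k r.
  by rewrite q'E evD evMn.
have Kn0 : K%:R != 0 :> algC by rewrite gt_eqF.
have K1 : 1 <= K%:R :> algC by rewrite ler1n; move: K0; rewrite ltr0n.
pose w k := ev k q' / K%:R.
have piece (z : {poly int}) : (size z <= m.+1)%N -> (forall k,
  `|ev k z - w k| <= D) -> bounded_cone B z.
  move=> z_m zw; apply: (@cone_piece B D (w ord0) w) => //.
  - by rewrite divr_gt0.
  - move=> k k0; rewrite /w mulrA normrM normfV (gtr0_norm K0).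
    by apply: ler_wpM2r; [rewrite invr_ge0 ltW | exact: q'k].
  - rewrite -ler_pdivrMl // mulrC /w ler_pdivlMr // mulrC.
    apply: le_trans (ltW Bq'); apply: le_trans B0B.
    apply: ler_wpDl; [by rewrite mulr_ge0 |
      by rewrite [leLHS]mulrC [X in _ * X]mulrC].
  - have B2 : B = B / 2 + B / 2 by field.
    rewrite B2; apply: lerD; last first.
      rewrite ler_pdivlMr //; apply: le_trans B0B; rewrite ler_wpDr //.
      by rewrite !mulr_ge0 ?invr_ge0 ?(ltW rt0) ?ler0n.
    rewrite /w ler_pdivrMr // evq'.
    apply: (@le_trans _ _ (lam ord0 * B)); first by rewrite ler_pM2l.
    have Bge0 := le_trans (ltW q0) qB.
    rewrite mulrAC ler_pdivlMr // mulrAC [leRHS]mulrC; apply: ler_wpM2r => //.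
    exact: ltW.
(* One piece takes the whole remainder. The pieces differ from the exact [K]-th part by [- r / K]
   and [r * (1 - 1 / K)], both within [D]. *)
exists ((p + r) :: nseq K.-1 p); split=> //.
  have bp : bounded_cone B p.
    apply: piece => // k;
      rewrite /w evE mulrDl mulrAC divff // mul1r opprD addNKr.
    rewrite normrN normrM normfV (gtr0_norm K0) ler_pdivrMr //.
    by apply: le_trans (rD k) _; rewrite ler_peMr.
  rewrite /= all_nseq bp orbT andbT; apply: piece.
    by rewrite (leq_trans (size_polyD _ _)) // geq_max p_m.
  move=> k; rewrite /w evE evD (_ : _ - _ = ev k r * (1 - K%:R^-1));
    last by field.
  rewrite normrM; apply: le_trans (rD k); rewrite ler_piMr //.
  by rewrite ger0_norm ?gerBl ?subr_ge0 ?invf_le1 ?invr_ge0 // ltW.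
move=> k; rewrite big_cons big_nseq -evq' evE evD.
rewrite (_ : iter _ _ _ = ev k p *+ K.-1); last first.
  by elim: (K.-1) => //= n ->; rewrite mulrS.
have -> : K%:R = 1 + K.-1%:R :> algC.
  by rewrite nat1r prednK // -(ltr0n algC).
by rewrite mulrDl mul1r mulr_natl addrAC.
Qed.

(** For [theta <= 1] the bound [B] on the dominant embedding holds for all conjugates of a point of
    the cone, so finitely many letters remain. *)
Lemma cone_letters : theta <= 1 ->
  exists (T : finType) (x0 : T) (val : T -> {poly int}) (H : T -> seq T),
  [/\ forall t, in_cone (val t), forall t, H t <> [::] &
    forall t k, \sum_(y <- H t) ev k (val y) = lam k * ev k (val t)].
Proof.
move=> theta1; have [B0 B00 splitP] := cone_split.
(* Once [rho ^+ J <= theta], the power [mu^J] lies in the cone and provides a starting letter,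
   provided [B >= lam_0 ^+ J]. *)
have [J JP] := expr_le_small _ _ (ltW rho_gt0) rho_lt1 theta_gt0.
pose B := B0 + lam ord0 ^+ J; have B_ge0 : 0 <= B.
  by rewrite addr_ge0 // exprn_ge0 // ltW.
have [C C0 CP] := coef_bound.
have [|N NP] := @exists_nat_gt (C * B); first by rewrite mulr_ge0.
have [s sP] := finitely_many_bounded N.
pose L := [seq q <- s | bounded_cone B q].
have LP q : (q \in L) = bounded_cone B q.
  rewrite mem_filter; case:
    (boolP (bounded_cone B q)) => //= /and3P[q_m /in_coneP[q0 qk] qB].
  apply: sP => // i; rewrite -(ler_int algC) intr_norm;
    apply: le_trans (ltW NP).
  apply: CP => // k; have [->|/qk] := eqVneq k ord0; first by rewrite gtr0_norm.
  by move=> /le_trans -> //; apply: le_trans qB; rewrite ler_piMl // ltW.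
have x0L : rmodp 'X^J P \in L.
  rewrite LP; apply/and3P; split; first exact: size_modP.
    apply/in_coneP; rewrite !ev_modP !evXn; split; first exact: exprn_gt0.
    move=> k k0; rewrite ev_modP evXn normrX;
      apply: (@le_trans _ _ ((rho * lam ord0) ^+ J)).
      by rewrite lerXn2r ?nnegrE ?lam_dom // mulr_ge0 ?ltW.
    by rewrite exprMn ler_wpM2r ?JP // exprn_ge0 ?ltW.
  by rewrite ev_modP evXn lerDr.
have lift (l : seq {poly int}) : all (bounded_cone B) l ->
    exists l' : seq (seq_sub L), map val l' = l.
  elim: l => [|q l IH] /=; first by exists [::].
  case/andP; rewrite -LP => qL /IH[l' <-].
  by exists (SeqSub qL :: l').
have /fin_all_exists[H HP] (t : seq_sub L) : exists l : seq (seq_sub L),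
    l <> [::] /\ forall k, \sum_(y <- l) ev k (val y) = lam k * ev k (val t).
  have tB : bounded_cone B (val t) by rewrite -LP; exact: valP.
  have [|l [l0 /lift[l' ll'] lE]] := splitP B (val t) _ tB.
    by rewrite lerDl exprn_ge0 // ltW.
  exists l'; split=> [l'0|k]; first by apply: l0; rewrite -ll' l'0.
  by rewrite -lE -ll' big_map.
exists (seq_sub L), (SeqSub x0L), val, H; split=> [t|t|t k].
- by have := valP t; rewrite /= LP => /and3P[].
- by case: (HP t).
- by case: (HP t).
Qed.

End Conjugates.

(** * Growth of a trace with one dominant conjugate *)

Section Growth.

Variables (m : nat) (lam c : 'I_m.+1 -> algC) (theta rho : algC)
  (g : nat -> nat).
Hypothesis rho_gt0 : 0 < rho.
Hypothesis rho_lt1 : rho < 1.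
Hypothesis theta_gt0 : 0 < theta.
Hypothesis theta_half : m%:R * theta <= 2^-1.
Hypothesis theta_gap : m%:R * theta * (lam ord0 + 2) <= lam ord0 - 2.
Hypothesis lam_gt0 : 0 < lam ord0.
Hypothesis lam_dom : forall k, k != ord0 -> `|lam k| <= rho * lam ord0.
Hypothesis c_gt0 : 0 < c ord0.
Hypothesis c_cone : forall k, k != ord0 -> `|c k| <= theta * c ord0.

Let lead i := lam ord0 ^+ i * c ord0.

Let lead_gt0 i : 0 < lead i.
Proof. by rewrite mulr_gt0 ?exprn_gt0. Qed.

Let lam_le k : k != ord0 -> `|lam k| <= lam ord0.
Proof.
by move=> k0; apply: le_trans (lam_dom k k0) _; rewrite ler_piMl // ltW.
Qed.

(** Each of the [m] other terms is at most [M * (rho lam_0)^i * theta c_0]. The factors [w k] will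
    be 1, [lam k - 2] and [lam k - lam ord0]. *)
Lemma tail_bound (M : algC) (w : 'I_m.+1 -> algC) i :
  (forall k, k != ord0 -> `|w k| <= M) ->
  `|\sum_(k | k != ord0) w k * (lam k ^+ i * c k)| <=
    m%:R * theta * M * rho ^+ i * lead i.
Proof.
move=> wM; pose b := M * ((rho * lam ord0) ^+ i * (theta * c ord0)).
have wb k : k != ord0 -> `|w k * (lam k ^+ i * c k)| <= b.
  move=> k0; rewrite !normrM normrX; apply: ler_pM;
    rewrite ?wM ?mulr_ge0 ?exprn_ge0 //.
  apply: ler_pM; rewrite ?exprn_ge0 ?c_cone //.
  by rewrite lerXn2r ?nnegrE ?lam_dom // mulr_ge0 ?ltW.
apply: le_trans (ler_norm_sum _ _ _) _; apply: le_trans (ler_sum _ wb) _.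
rewrite [leRHS](_ : _ = m%:R * b); last by rewrite /b /lead exprMn; ring.
rewrite sumr_const mulr_natl (_ : #|_| = m) //.
transitivity #|predC1 (ord0 : 'I_m.+1)|; first exact: eq_card.
by rewrite cardC1 card_ord.
Qed.

Let addr_norm_ge0 (x R : algC) : R \is Num.real -> `|R| <= x -> 0 <= x + R.
Proof. by move=> RR Rx; rewrite addrC -[x]opprK subr_ge0 real_lerNnormlW. Qed.

Let rho_le1 i : rho ^+ i <= 1.
Proof. by rewrite exprn_ile1 // ltW. Qed.

Let lead_real i : lead i \is Num.real := gtr0_real (lead_gt0 i).

(** By [theta_half] the tail is at most half of the dominant term. Stated without [g], it also
    yields the positivity of traces that spelling lengths require. *)
Lemma lead_le_sum i : \sum_k lam k ^+ i * c k \is Num.real ->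
  lead i <= 2 * \sum_k lam k ^+ i * c k.
Proof.
rewrite -subr_ge0 (bigD1 ord0) //= -/(lead i); set R := \sum_(k | _) _ => sR.
have RR : R \is Num.real.
  by rewrite -[R](addKr (lead i)) rpredD ?rpredN ?lead_real.
have -> : 2 * (lead i + R) - lead i = lead i + 2 * R by ring.
apply: addr_norm_ge0; first by rewrite rpredM ?realn.
have := @tail_bound 1 (fun=> 1) i;
  rewrite (eq_bigr (fun k => lam k ^+ i * c k)); last first.
  by move=> k _; rewrite mul1r.
rewrite -/R mulr1 => Rle; rewrite normrM ger0_norm // mulrC -ler_pdivlMr //.
apply: le_trans (Rle _) _; first by move=> *; rewrite normr1.
rewrite [leRHS]mulrC; apply: ler_wpM2r; first exact: ltW.
by apply: le_trans theta_half; rewrite ler_piMr // mulr_ge0 // ltW.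
Qed.

Hypothesis gE : forall i, (g i)%:R = \sum_k lam k ^+ i * c k.

Lemma lead_le i : lead i <= 2 * (g i)%:R.
Proof. by rewrite gE lead_le_sum // -gE realn. Qed.

Let growth_diff (x : algC) i :
  (g i.+1)%:R - x * (g i)%:R =
  (lam ord0 - x) * lead i +
    \sum_(k | k != ord0) (lam k - x) * (lam k ^+ i * c k).
Proof.
rewrite !gE mulr_sumr -sumrB (bigD1 ord0) //= /lead; congr (_ + _).
  by rewrite exprS; ring.
by apply: eq_bigr => k _; rewrite exprS; ring.
Qed.

(** By [theta_gap] the dominant part [(lam_0 - 2) * lead i] outweighs the tail. *)
Lemma growth_double i : (2 * g i <= g i.+1)%N.
Proof.
rewrite -(ler_nat algC) natrM -subr_ge0 growth_diff; set R := \sum_(k | _) _.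
apply: addr_norm_ge0.
  have -> : R = (g i.+1)%:R - 2 * (g i)%:R - (lam ord0 - 2) * lead i.
    by rewrite growth_diff addrAC subrr add0r.
  apply: rpredB; first by rewrite rpredB ?rpredM ?realn.
  by apply: rpredM; rewrite ?lead_real // rpredB ?realn ?gtr0_real.
apply: (@le_trans _ _ (m%:R * theta * (lam ord0 + 2) * rho ^+ i * lead i)).
  apply: tail_bound => k k0; apply: le_trans (ler_normB _ _) _.
  by rewrite (ger0_norm (_ : 0 <= 2)) // lerD2r lam_le.
apply: ler_wpM2r; first exact: ltW.
apply: le_trans theta_gap; rewrite ler_piMr //.
by rewrite !mulr_ge0 ?addr_ge0 ?ler0n ?(ltW theta_gt0) ?(ltW lam_gt0).
Qed.

(** Subtracting [lam_0] times [g i] cancels the dominant term; the tail is smaller by the factor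
    [rho ^+ i]. *)
Lemma growth_ratio i :
  `|(g i.+1)%:R - lam ord0 * (g i)%:R| <= 2 * lam ord0 * rho ^+ i * (g i)%:R.
Proof.
rewrite growth_diff subrr mul0r add0r.
apply: le_trans (tail_bound (lam ord0 * 2) _ i _) _.
  move=> k k0; apply: le_trans (ler_normB _ _) _.
  by rewrite mulr_natr mulr2n (gtr0_norm lam_gt0) lerD2r lam_le.
have -> : m%:R * theta * (lam ord0 * 2) * rho ^+ i * lead i =
  (m%:R * theta) * (lam ord0 * rho ^+ i * lead i * 2) by ring.
apply: (@le_trans _ _ (2^-1 * (lam ord0 * rho ^+ i * lead i * 2))).
  by apply: ler_wpM2r => //; rewrite !mulr_ge0 ?exprn_ge0 // ltW.
have -> : 2^-1 * (lam ord0 * rho ^+ i * lead i * 2) =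
  (lam ord0 * rho ^+ i) * lead i by field.
have -> : 2 * lam ord0 * rho ^+ i * (g i)%:R =
  (lam ord0 * rho ^+ i) * (2 * (g i)%:R) by ring.
by apply: ler_wpM2l; rewrite ?lead_le // mulr_ge0 ?exprn_ge0 // ltW.
Qed.

End Growth.

(** * Conjugates of a Perron number *)

Lemma uniform_gap (mu : algC) (s : seq algC) : 0 < mu ->
  (forall z, z \in s -> `|z| < mu) ->
  exists rho : algC,
    [/\ 0 < rho, rho < 1 & forall z, z \in s -> `|z| <= rho * mu].
Proof.
move=> mu0; elim: s => [_|z s IH zs].
  exists 2^-1; split=> //; first by rewrite invr_gt0.
  by rewrite invf_lt1 // ltr1n.
have [|rho [r0 r1 rs]] := IH; first by move=> y ys;
  rewrite zs // in_cons ys orbT.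
have zr : `|z| / mu \is Num.real
  by rewrite rpredM ?rpredV ?normr_real ?gtr0_real.
have [rz|zr'] := real_leP (gtr0_real r0) zr.
  exists (`|z| / mu); split=> [||y]; first exact: lt_le_trans rz.
    by rewrite ltr_pdivrMr // mul1r zs ?mem_head.
  rewrite in_cons => /orP[/eqP->|/rs yrho]; first by rewrite divfK ?gt_eqF.
  by apply: le_trans yrho _; rewrite ler_pM2r.
exists rho; split=> // y; rewrite in_cons => /orP[/eqP->|/rs //].
by rewrite -ler_pdivrMr // ltW.
Qed.

(** The minimal polynomial over the rationals is irreducible, and in characteristic 0 its derivative
    is nonzero of smaller degree, hence coprime to it. *)
Lemma separable_minCpoly (x : algC) : separable_poly (minCpoly x).
Proof.
have [p [Dp p_monic minp]] := minCpolyP x; rewrite Dp separable_map.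
have p0 := monic_neq0 p_monic.
have sp : (1 < size p)%N by have := size_minCpoly x; rewrite Dp size_map_poly.
have p_irr : irreducible_poly p.
  split=> // q q1 qp; rewrite /eqp qp /= -minp.
  have pE := divpK qp; have := root_minCpoly x.
  rewrite Dp -pE rmorphM rootM => /orP[pq_x|//].
  have p_pq : p %| p %/ q by rewrite -minp.
  move: (@dvdp_leq _ p (p %/ q)).
  have /andP[r0 q0] : (p %/ q != 0) && (q != 0)
    by rewrite -negb_or -mulf_eq0 pE.
  move=> /(_ r0 p_pq); rewrite -{1}pE size_mul // -ltnS.
  have : (0 < size q)%N by rewrite size_poly_gt0.
  by case: (size q) q1 => [|[|k]] // _ _;
    rewrite !addnS /= ltnS -ltn_subRL subnn.
rewrite separable_poly.unlock irreducible_poly_coprime //.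
have p'0 : p^`() != 0.
  apply: contraTneq sp => /(congr1 (fun q : {poly rat} => q`_(size p).-2)).
  case sE : (size p) => [|[|k]] //=; rewrite coef_deriv coef0 => /eqP.
  rewrite mulrn_eq0 /= -[k.+1]/(k.+2.-1) -sE -[_`_ _]/(lead_coef p).
  by rewrite (monicP p_monic) oner_eq0.
by apply/negP => /(dvdp_leq p'0); rewrite leqNgt lt_size_deriv.
Qed.

(* When [mu = 2] the growth [2 g_i <= g_(i+1)] leaves no room for other
   conjugates, hence the last alternative. *)
Lemma perron_conjugates (mu : algC) : perron mu -> 2 <= mu ->
  exists (m : nat) (lam : 'I_m.+1 -> algC) (P : {poly int}) (rho : algC),
  [/\ P \is monic, map_poly intr P = \prod_k ('X - (lam k)%:P),
      injective lam & lam ord0 = mu] /\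
  [/\ 0 < rho, rho < 1, forall k, k != ord0 -> `|lam k| <= rho * mu &
      m = 0%N \/ 2 < mu].
Proof.
case=> mu_int mu0 mu_dom; rewrite le_eqVlt => /orP[/eqP <-|mu2].
  exists 0%N, (fun=> 2), ('X - 2%:P), 2^-1; split; split=> //.
  - exact: monicXsubC.
  - by rewrite big_ord1 rmorphB /= map_polyX map_polyC /= rmorph_nat.
  - by move=> i j _; rewrite !ord1.
  - by rewrite invr_gt0.
  - by rewrite invf_lt1 // ltr1n.
  - by move=> k; rewrite ord1.
  - by left.
have [P DP] := floorpP mu_int.
have P_monic : P \is monic.
  have := minCpoly_monic mu; rewrite DP !monicE lead_coef_map_inj //.
    by rewrite -(inj_eq (intr_inj : injective (intr : int -> algC))).
  exact: intr_inj.
have [rs] := closed_field_poly_normal (minCpoly mu).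
rewrite (monicP (minCpoly_monic mu)) scale1r => Drs.
have rsu : uniq rs by rewrite -separable_prod_XsubC -Drs separable_minCpoly.
have mu_rs : mu \in rs by rewrite -root_prod_XsubC -Drs root_minCpoly.
(* Moving [mu] to the front of the roots gives it the index [ord0]. *)
have rsP := perm_to_rem mu_rs; set s := rem mu rs in rsP.
have mus_u : uniq (mu :: s) by rewrite -(perm_uniq rsP).
have [|rho [r0 r1 rP]] := uniform_gap mu s mu0.
  move=> z zs; apply: mu_dom;
    first by rewrite Drs root_prod_XsubC (perm_mem rsP) in_cons zs orbT.
  by apply: contraTneq zs => ->; case/andP: mus_u.
exists (size s), (fun k => nth 0 (mu :: s) k), P, rho; split; split=> //.
- by rewrite -DP Drs (perm_big _ rsP) /= (big_nth 0) big_mkord.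
- by move=> i j /eqP; rewrite nth_uniq // => /eqP/val_inj.
- case=> [[|k]] ks // _ /=; apply: rP; exact: mem_nth.
- by right.
Qed.

(** * Assembling the word *)

Lemma sum_morph_iter (S : Type) (H : S -> seq S) (f : S -> algC)
  (l : algC) i s :
  (forall x, \sum_(y <- H x) f y = l * f x) ->
  \sum_(y <- morph_iter H i s) f y = l ^+ i * \sum_(y <- s) f y.
Proof.
move=> Hf; elim: i => [|i IH] /=; first by rewrite mul1r.
rewrite exprS -mulrA -IH /morph_word big_flatten big_map mulr_sumr.
by apply: eq_bigr.
Qed.

Theorem theorem5 (mu : algC) :
  perron mu -> 2 <= mu ->
  exists w : nat -> bool,
    morphic_binary w /\
    exists n : nat -> nat,
      (forall j, (n j < n j.+1)%N) /\
      (forall k, w k = true <-> exists j, n j = k) /\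
      (0 < n 0)%N /\
      (forall j, 2 <= (n j.+1)%:R / (n j)%:R :> algC) /\
      limsup_eq (fun j => (n j.+1)%:R / (n j)%:R) mu.
Proof.
move=> mu_perron mu2.
have mu0 : 0 < mu by case: mu_perron.
have [m [lam [P [rho [[P_monic P_roots lam_inj lam0]]]]]] :=
  perron_conjugates mu mu_perron mu2.
case=> rho0 rho1 lam_dom m_mu.
have lam_gt0 : 0 < lam ord0 by rewrite lam0.
have muD2 : 0 < mu + 2 by rewrite addr_gt0.
have [theta [theta0 theta1 theta_half theta_gap]] : exists theta : algC,
    [/\ 0 < theta, theta <= 1, m%:R * theta <= 2^-1 &
        m%:R * theta * (mu + 2) <= mu - 2].
  case: m_mu => [m0|mu_gt2].
    exists 1; rewrite (_ : m%:R = 0) ?m0 // !mul0r.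
    by split; rewrite ?invr_ge0 ?subr_ge0 ?ler0n ?ltr01.
  (* Taking [theta = q / (2 (m + 1))] gives [m theta <= q / 2]; as [q <= 1], this meets both bounds
     on [m theta]. *)
  pose q := (mu - 2) / (mu + 2).
  have q0 : 0 < q by rewrite divr_gt0 // subr_gt0.
  have q1 : q <= 1.
    rewrite ler_pdivrMr // mul1r lerBlDr -addrA lerDl.
    by rewrite addr_ge0.
  have mq : m%:R * (q / (2 * m.+1%:R)) <= q / 2.
    have -> : m%:R * (q / (2 * m.+1%:R)) = q / 2 * (m%:R / m.+1%:R).
      by field; rewrite nat1r pnatr_eq0.
    apply: ler_piMr; first by rewrite divr_ge0 ?(ltW q0) ?ler0n.
    by rewrite ler_pdivrMr ?ltr0n // mul1r ler_nat.
  exists (q / (2 * m.+1%:R)); split.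
  - by rewrite divr_gt0 // mulr_gt0 ?ltr0n.
  - rewrite ler_pdivrMr ?mulr_gt0 ?ltr0n // mul1r; apply: le_trans q1 _.
    by rewrite -natrM ler1n.
  - by apply: le_trans mq _; rewrite -[leRHS]mul1r ler_wpM2r ?invr_ge0.
  - rewrite -ler_pdivlMr // -/q; apply: le_trans mq _.
    by rewrite ler_pdivrMr // ler_peMr ?(ltW q0) // ler1n.
rewrite -lam0 in lam_dom theta_gap.
have [T [x0 [v [H [v_cone H0 HE]]]]] :=
  cone_letters m lam P P_monic P_roots lam_inj theta rho theta0 rho0 rho1
    lam_gt0 lam_dom theta1.
pose c t k := ev m lam k (v t).
have c_gt0 t : 0 < c t ord0 by case/in_coneP: (v_cone t).
have c_cone t k : k != ord0 -> `|c t k| <= theta * c t ord0.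
  by case/in_coneP: (v_cone t) => _; exact.
have sum_int t : \sum_k c t k \in Num.int by apply: (sum_ev_int _ _ P).
have sum_gt0 t : 0 < \sum_k c t k.
  have sE : \sum_k c t k = \sum_k lam k ^+ 0 * c t k.
    by apply: eq_bigr => k _; rewrite mul1r.
  rewrite -(pmulr_rgt0 _ (_ : 0 < 2)) //; apply: lt_le_trans (c_gt0 t) _.
  have := lead_le_sum m lam (c t) theta rho rho0 rho1 theta0 theta_half
    lam_gt0 lam_dom (c_gt0 t) (c_cone t) 0.
  by rewrite mul1r -sE; apply; exact: Rreal_int.
(* The spelling length of a letter is its trace, a positive integer. *)
have /fin_all_exists[l lE] (t : T) : exists n : nat, n%:R = \sum_k c t k.
  have /natrP[n nE] : \sum_k c t k \in Num.nat by rewrite natrEint sum_int ltW.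
  by exists n.
have l_gt0 t : (0 < l t)%N by rewrite -(ltr0n algC) lE.
have gE i : (weight T H l x0 i)%:R = \sum_k lam k ^+ i * c x0 k.
  (* For each [k], the embedding [c ^~ k] is a left eigenvector of the substitution, with eigenvalue
     [lam k]. *)
  rewrite /weight natr_sum (eq_bigr (fun t => \sum_k c t k)) // exchange_big /=.
  apply: eq_bigr => k _;
    rewrite (sum_morph_iter _ _ (c ^~ k) (lam k)) ?big_seq1 //.
  by move=> t; exact: HE.
have [w [w_morphic wE]] := weighted_word T H l x0 H0 l_gt0.
have g_double := growth_double _ _ _ _ _ _ rho0 rho1 theta0 theta_gap lam_gt0
  lam_dom (c_gt0 x0) (c_cone x0) gE.
have g_ratio := growth_ratio _ _ _ _ _ _ rho0 rho1 theta0 theta_half lam_gt0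
  lam_dom (c_gt0 x0) (c_cone x0) gE.
exists w; split=> //; exists (marker T H l x0).
have g_gt0 := weight_gt0 T H l x0 H0 l_gt0.
have n_gt := marker_gt T H l x0 H0 l_gt0; have nS := markerS T H l x0.
have n_gt0 j : 0 < (marker T H l x0 j)%:R :> algC
  by rewrite ltr0n (leq_trans _ (n_gt j)).
(* Doubling gives [n_(j+1) = n_j + g_j <= 2 g_j <= g_(j+1)]; then
   [n_(j+1) / n_j = 1 + g_j / n_j >= 2]. *)
have n_le_g j : (marker T H l x0 j <= weight T H l x0 j)%N.
  elim: j => [|j IH]; first by rewrite /marker big_ord0.
  by rewrite nS; apply: leq_trans (g_double j); rewrite mul2n -addnn leq_add2r.
split; first by move=> j; rewrite nS -[X in (X < _)%N]addn0 ltn_add2l g_gt0.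
split=> //; split; first exact: leq_trans (n_gt _).
split=> [j|]; first by rewrite ler_pdivlMr // -natrM ler_nat nS mul2n
  -addnn leq_add2l.
apply: limsup_eq_cvg => [j||]; first by rewrite rpredM ?rpredV ?realn.
  exact: gtr0_real.
apply: (ratio_cvg (weight T H l x0)) => // e e0.
(* The bound [e / (2 mu)] compensates the factor [2 lam_0] in [g_ratio]. *)
have [J JP] := expr_le_small rho (e / (2 * mu)) (ltW rho0) rho1
  (divr_gt0 e0 (mulr_gt0 (ltr0n _ 2) mu0)).
exists J => i Ji; rewrite -lam0; apply: le_trans (g_ratio i) _.
apply: ler_wpM2r => //; rewrite lam0 mulrC -ler_pdivlMr ?mulr_gt0 //.
exact: JP.
Qed.
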